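(* Let $X$ be a non-discrete Fréchet–Urysohn Tychonoff space. If $X$ is crowded, then the hyperspace $\mathcal{S}_c(X)$ of nontrivial convergent sequences of $X$ is meager (in itself).
   Context: All spaces are Tychonoff (completely regular and Hausdorff). A space is crowded if it has no isolated points. $X$ is Fréchet–Urysohn if whenever $x\in \overline{A}$, some sequence of points of $A$ converges to $x$. A nontrivial convergent sequence of $X$ is a subset $S\subseteq X$ such that $|S|=\omega$, $S$ (as a subspace) has a unique non-isolated point, denoted $x_S$, and $|S\setminus U|<\omega$ for each neighborhood $U$ of $x_S$. Let $\mathcal{CL}(X)$ be the set of all nonempty closed subsets of $X$, with the Vietoris topology: a base consists of the sets $\langle \mathcal{U}\rangle=\{F\in\mathcal{CL}(X): F\subseteq\bigcup\mathcal{U}\text{ and }F\cap U\neq\emptyset\text{ for all }U\in\mathcal{U}\}$, where $\mathcal{U}$ runs over nonempty finite families of nonempty open subsets of $X$. Let $\mathcal{S}_c(X)=\{S\in\mathcal{CL}(X): S\text{ is a nontrivial convergent sequence of }X\}$ with the subspace topology. A space is meager if it is a countable union of nowhere dense subsets of itself. *)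

(* Defs.v *)
From HB Require Import structures.
From mathcomp Require Import all_boot.
From mathcomp Require Import all_classical all_reals topology normedtype.

Set Implicit Arguments.
Unset Strict Implicit.
Unset Printing Implicit Defensive.

Local Open Scope classical_set_scope.
Local Open Scope card_scope.

Definition tychonoff_space (X : topologicalType) : Prop :=
  completely_regular_space X /\ hausdorff_space X.

Definition discrete_space (X : topologicalType) : Prop :=
  forall A : set X, open A.

Definition crowded (X : topologicalType) : Prop :=
  forall x : X, ~ isolated [set: X] x.

Definition frechet_urysohn (X : topologicalType) : Prop :=
  forall (A : set X) (x : X), closure A x ->
    exists u : nat -> X, (forall n, A (u n)) /\ u @ \oo --> x.

Definition nowhere_dense (T : topologicalType) (A : set T) : Prop :=
  (closure A)° = set0.

Definition meager (T : topologicalType) (A : set T) : Prop :=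
  exists N : nat -> set T,
    (forall n, nowhere_dense (N n)) /\ A = \bigcup_n N n.

Definition meager_space (T : topologicalType) : Prop := meager [set: T].

(* The point [x] is the limit x_S: the only non-isolated point of the
   subspace [S]. *)
Definition nontrivial_convergent_sequence (X : topologicalType) (S : set X) :
    Prop :=
  S #= [set: nat] /\
  exists x : X, S `\` isolated S = [set x] /\
    (forall U : set X, nbhs x U -> finite_set (S `\` U)).

Definition nonempty_closed (X : topologicalType) : set (set X) :=
  [set F | closed F /\ F !=set0].

Definition CL (X : topologicalType) : Type := {F : set X | nonempty_closed F}.

HB.instance Definition _ (X : topologicalType) := gen_eqMixin (CL X).
HB.instance Definition _ (X : topologicalType) := gen_choiceMixin (CL X).

Definition vietoris_index (X : topologicalType) : set (set (set X)) :=
  [set U | [/\ finite_set U, U !=set0 &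
               forall V, U V -> open V /\ V !=set0]].

Definition vietoris_basic (X : topologicalType) (U : set (set X)) :
    set (CL X) :=
  [set F | sval F `<=` \bigcup_(V in U) V /\
           forall V, U V -> sval F `&` V !=set0].

Lemma vietoris_cover (X : topologicalType) :
  \bigcup_(U in @vietoris_index X) @vietoris_basic X U = setT.
Proof.
apply/seteqP; split=> // -[F [cF [x Fx]]] _.
exists [set [set: X]]; last first.
  split=> [y _ /=|V /= ->]; first by exists setT.
  by exists x.
split; [exact: finite_set1|by exists setT|].
by move=> V /= ->; split; [exact: openT|by exists x].
Qed.

Lemma vietoris_join (X : topologicalType) (U V : set (set X)) (F : CL X) :
  vietoris_index U -> vietoris_index V ->
  vietoris_basic U F -> vietoris_basic V F ->
  exists W, [/\ vietoris_index W, vietoris_basic W F &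
    vietoris_basic W `<=` vietoris_basic U `&` vietoris_basic V].
Proof.
move=> [finU [u0 Uu0] oU] [finV _ oV] [FU FmU] [FV FmV].
pose cU := \bigcup_(A in U) A; pose cV := \bigcup_(A in V) A.
have ocU : open cU by apply: bigcup_open => A /oU[].
have ocV : open cV by apply: bigcup_open => A /oV[].
have meetU A : U A -> sval F `&` (A `&` cV) !=set0.
  by move=> /FmU[x [Fx Ax]]; exists x; split=> //; split=> //; exact: FV.
have meetV A : V A -> sval F `&` (A `&` cU) !=set0.
  by move=> /FmV[x [Fx Ax]]; exists x; split=> //; split=> //; exact: FU.
exists ([set A `&` cV | A in U] `|` [set A `&` cU | A in V]); split.
- split.
  + by rewrite finite_setU; split; exact: finite_image.
  + by exists (u0 `&` cV); left; exists u0.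
  + move=> _ [] [A UA <-].
      split; first by apply: openI => //; have [] := oU _ UA.
      by have [x [_ ?]] := meetU _ UA; exists x.
    split; first by apply: openI => //; have [] := oV _ UA.
    by have [x [_ ?]] := meetV _ UA; exists x.
- split.
    move=> x Fx; have [A UA Ax] := FU _ Fx.
    exists (A `&` cV); first by left; exists A.
    by split=> //; exact: FV.
  by move=> _ [] [A ? <-]; [exact: meetU|exact: meetV].
- move=> G [GW GmW]; split; split.
  + move=> x /GW[_ [] [A UA <-] [Ax cx]]; last exact: cx.
    by exists A.
  + move=> A UA; have [|x [Gx [Ax _]]] := GmW (A `&` cV).
      by left; exists A.
    by exists x.
  + move=> x /GW[_ [] [A VA <-] [Ax cx]]; first exact: cx.
    by exists A.
  + move=> A VA; have [|x [Gx [Ax _]]] := GmW (A `&` cU).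
      by right; exists A.
    by exists x.
Qed.

HB.instance Definition _ (X : topologicalType) :=
  isBaseTopological.Build (CL X) (@vietoris_cover X) (@vietoris_join X).

Lemma vietoris_openP (X : topologicalType) (O : set (CL X)) :
  open O <-> exists2 D, D `<=` @vietoris_index X &
               \bigcup_(U in D) vietoris_basic U = O.
Proof. by []. Qed.

(* As a type, [Sc X] carries the library's subspace topology on [set_type]. *)
Definition Sc (X : topologicalType) : set (CL X) :=
  [set F | nontrivial_convergent_sequence (sval F)].
Arguments Sc X : clear implicits.

(* Main.v *)
Require Import Defs.
From HB Require Import structures.
From mathcomp Require Import all_boot.
From mathcomp Require Import all_classical all_reals topology normedtype.

(** Why the theorem holds.  A convergent sequence cannot have infinitely many
    points in each of two open sets [A] and [B] with disjoint closures, because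
    its limit would lie in both closures ([limit_closure]).  On the other hand
    every member [S] of [Sc X] has a neighbourhood in which all members meet
    two such sets: separate two points of [S].  So this neighbourhood is
    covered by the sets
      [{T : T meets A but has fewer than n points in A}],
    over all [n], together with their analogues for [B].  Each of these is
    nowhere dense ([nowhere_dense_few]): if [T] meets the open set [A], then,
    [X] being crowded, finitely many points of [A] close to a point of [T] can
    be added to [T], and this yields an element of [Sc X], arbitrarily close
    to [T], with [n] points in [A]; having at least [n] points in [A] is an
    open condition in the Vietoris topology.

    Hence [Sc X] is locally meager.  The pairs [(A, B)] cannot in general be
    taken from a countable family, so the passage to [Sc X] itself is Banach's
    category theorem ([meager_space_local]). *)

Set Implicit Arguments.
Unset Strict Implicit.
Unset Printing Implicit Defensive.

Local Open Scope classical_set_scope.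
Local Open Scope card_scope.

(** * Banach's category theorem *)

Lemma nowhere_denseP (T : topologicalType) (A : set T) :
  nowhere_dense A <->
  forall W, open W -> W !=set0 ->
    exists V, [/\ open V, V !=set0, V `<=` W & V `&` A = set0].
Proof.
split=> [ndA W oW [x Wx]|dA].
  have [y [Wy nAy]] : exists y, W y /\ ~ closure A y.
    apply: contrapT => WA; suff : (closure A)° x by rewrite ndA.
    apply: filterS (open_nbhs_nbhs (conj oW Wx)) => y Wy.
    by apply: contrapT => nAy; apply: WA; exists y.
  exists (W `&` ~` closure A); split; last 2 first.
  - exact: subIsetl.
  - by rewrite -subset0 => z [[_ nAz] Az]; apply/nAz/subset_closure.
  - by apply: openI => //; exact/closed_openC/closed_closure.
  - by exists y.
rewrite /nowhere_dense -subset0 => x Ax.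
have [|V [oV [y Vy] VA VA0]] := dA _ (open_interior (closure A)).
  by exists x.
have [z] := interior_subset (VA _ Vy) _ (open_nbhs_nbhs (conj oV Vy)).
by rewrite setIC VA0.
Qed.

(** Take a maximal disjoint family [E] of open sets, each with a countable
    nowhere dense cover.  As its members are open and disjoint, the union over
    [E] of the [m]-th pieces is again nowhere dense, so the union of [E] is
    meager.  By maximality that union is dense, so that its complement is
    nowhere dense too. *)
Lemma meager_space_local (T : topologicalType) :
  (forall x : T, exists V N, [/\ open V, V x, forall n, nowhere_dense (N n) &
    V `<=` \bigcup_(n : nat) N n]) -> meager_space T.
Proof.
move=> locT.
pose covers (O : set T) (N : nat -> set T) :=
  (forall n, nowhere_dense (N n)) /\ O `<=` \bigcup_n N n.
pose D := [set O : set T | open O /\ exists N, covers O N].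
have [E [ED tE maxE]] := ex_maximal_disjoint_subcollection id D.
have /choice[N NE] O : exists N, E O -> covers O N.
  have [/ED[_ [N cN]]|nEO] := pselect (E O); first by exists N.
  by exists (fun=> set0).
have eqE O O' x : E O -> E O' -> O x -> O' x -> O = O'.
  by move=> EO EO' Ox O'x; apply: tE => //; exists x.
exists (fun n => if n is m.+1 then \bigcup_(O in E) (O `&` N O m)
                 else ~` \bigcup_(O in E) O); split; last first.
  apply/seteqP; split=> // x _.
  have [[O EO Ox]|nEx] := pselect ((\bigcup_(O in E) O) x); last by exists 0.
  have [_ /(_ _ Ox)[m _ Nx]] := NE _ EO.
  by exists m.+1 => //; exists O.
case=> [|m]; apply/nowhere_denseP => W oW [x Wx].
  (* Otherwise [V `&` W], for a covered neighbourhood [V] of [x], could be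
     added to [E]. *)
  have [O EO [y [Wy Oy]]] : exists2 O, E O & W `&` O !=set0.
    apply: contrapT => nWE.
    have [V [M [oV Vx ndM VM]]] := locT x.
    apply: (maxE (E `|` [set V `&` W])).
    - split; first exact: subsetUl.
      move=> /(_ (V `&` W))/(_ (or_intror erefl)) EVW.
      by apply: nWE; exists (V `&` W) => //; exists x.
    - move=> O [/ED //|->]; split; first exact: openI.
      by exists M; split=> // y [/VM].
    - move=> O O' [EO|->] [EO'|->] //.
      + exact: tE.
      + by move=> [y [Oy [_ Wy]]]; case: nWE; exists O => //; exists y.
      + by move=> [y [[_ Wy] Oy]]; case: nWE; exists O' => //; exists y.
  exists (W `&` O); split.
  - by apply: openI => //; have [] := ED _ EO.
  - by exists y.
  - exact: subIsetl.
  - by rewrite -subset0 => z [[_ Oz]]; apply; exists O.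
(* A set [W] that meets the [m]-th layer [M] does so inside one member [O] of
   [E], and [M] agrees there with the nowhere dense set [N O m]. *)
set M := \bigcup_(_ in _) _.
have [WM0|/eqP/set0P[y [Wy [O EO [Oy _]]]]] := pselect (W `&` M = set0).
  by exists W; split=> //; exists x.
have [oO _] := ED _ EO.
have /nowhere_denseP/(_ _ (openI oW oO))[|V [oV V0 VWO VN]] := (NE _ EO).1 m.
  by exists y.
exists V; split=> //; first by move=> z /VWO[].
rewrite -subset0 => z [Vz [O' EO' [O'z Nz]]].
have [_ Oz] := VWO _ Vz.
have eqO := eqE _ _ _ EO EO' Oz O'z; rewrite -eqO in Nz.
by have : (V `&` N O m) z by []; rewrite VN.
Qed.

(** * Separation *)

Lemma hausdorff_disjoint_open (X : topologicalType) (x y : X) :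
  hausdorff_space X -> x != y ->
  exists U V, [/\ open U, open V, U x, V y & U `&` V = set0].
Proof.
rewrite open_hausdorff => h /h[[U V] /= [/set_mem Ux /set_mem Vy]].
move=> [oU oV /eqP UV].
by exists U, V.
Qed.

(** The uniformity [UT] that separates [x] from the complement of [O] is itself
    regular at [x].  As its topology is coarser than that of [X], neighbourhoods
    for [UT] are neighbourhoods in [X], and closures in [X] are contained in
    closures for [UT]. *)
Lemma completely_regular_is_regular (X : topologicalType) :
  completely_regular_space X -> regular_space X.
Proof.
move=> crX x U xU.
have [O [oO Ox] OU] : exists2 O, open_nbhs x O & O `<=` U.
  by move: xU; rewrite /= nbhsE.
have [|uT [E [/=]]] := crX x (~` O) (open_closedC oO); first by apply.
set UT := Uniform.Pack uT => entE xOE le_nbhs.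
have [V Vx VE] : filter_from (@nbhs UT UT x) (@closure UT) (xsection E x).
  by apply: uniform_regular; exact: (@nbhs_entourage UT).
exists V; first exact: le_nbhs.
move=> y /= Vy; apply: OU; apply: contrapT => nOy.
have : ([set x] `*` ~` O `&` E) (x, y).
  split=> //; apply: set_mem; apply: VE => B /le_nbhs; exact: Vy.
by rewrite xOE.
Qed.

Lemma disjoint_closures (X : topologicalType) (x y : X) :
  tychonoff_space X -> x != y ->
  exists A B, [/\ open A, open B, A x, B y & closure A `&` closure B = set0].
Proof.
move=> [crX hX] /(hausdorff_disjoint_open hX)[A [V [oA oV Ax Vy AV]]].
have [W Wy WV] :=
  completely_regular_is_regular crX (open_nbhs_nbhs (conj oV Vy)).
exists A, W°; split=> //; first exact: open_interior.
rewrite -subset0 => z [Az /(closure_subset (@interior_subset _ W))/WV Vz].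
by have [t] := Az _ (open_nbhs_nbhs (conj oV Vz)); rewrite AV.
Qed.

(** * Sets with many points in an open set *)

(** For open [A] in a Hausdorff space this amounts to [S `&` A] having at least
    [n] points.  The points are witnessed by disjoint open sets in order to make
    the condition visibly open in [S] (see [open_openly_many]). *)
Fixpoint openly_many (X : topologicalType) n (A S : set X) : Prop :=
  if n is m.+1 then
    exists U, [/\ open U, U `<=` A, S `&` U !=set0 & openly_many m (A `\` U) S]
  else True.

Lemma openly_many_sub (X : topologicalType) n (A B S T : set X) :
  A `<=` B -> S `<=` T -> openly_many n A S -> openly_many n B T.
Proof.
elim: n A B => // n IH A B AB ST [U [oU UA [x [Sx Ux]] mS]].
exists U; split=> //; first exact: subset_trans AB.
  by exists x; split=> //; exact: ST.
by apply: IH mS => //; exact: setSD.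
Qed.

Lemma openly_many_infinite (X : topologicalType) (A S : set X) :
  (forall n, openly_many n A S) -> infinite_set (S `&` A).
Proof.
move=> mS /finite_seqP[s sE].
have points n B : openly_many n B S ->
    exists l : seq X, [/\ uniq l, size l = n & {in l, forall x, (S `&` B) x}].
  elim: n B => [|n IH] B /=; first by exists [::].
  move=> [U [_ UB [x [Sx Ux]] /IH[l [ul sl lB]]]].
  exists (x :: l); split=> /=; last 2 first.
  - by rewrite sl.
  - move=> y; rewrite inE => /orP[/eqP ->|/lB[Sy [By _]]] //.
    by split=> //; exact: UB.
  - by rewrite ul andbT; apply/negP => /lB[_ []].
have [l [ul sl lSA]] := points _ _ (mS (size s).+1).
have : (size l <= size s)%N.
  by apply: uniq_leq_size => // x /lSA; rewrite sE.
by rewrite sl ltnn.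
Qed.

(** A nonempty open set has two points; keep a neighbourhood of one of them for
    the first witness, and look for the other witnesses near the second. *)
Lemma crowded_finite_openly_many (X : topologicalType) n (A : set X) :
  hausdorff_space X -> crowded X -> open A -> A !=set0 ->
  exists F, [/\ finite_set F, F `<=` A & openly_many n A F].
Proof.
move=> hX cX; elim: n A => [|n IH] A oA [x Ax]; first by exists set0; split.
have [y [Ay yx]] : exists y, A y /\ x != y.
  apply: contrapT => nA; apply: (cX x); split; first exact: mem_set.
  exists A; first exact: open_nbhs_nbhs.
  rewrite setIT; apply/seteqP; split=> [y Ay|_ -> //].
  apply: contrapT => nyx; apply: nA; exists y; split=> //.
  by apply/eqP => xy; apply: nyx.
have [U [V [oU oV Ux Vy UV]]] := hausdorff_disjoint_open hX yx.
have [|F [fF FA mF]] := IH (A `&` V) (openI oA oV); first by exists y.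
exists (x |` F); split.
- by rewrite finite_setU; split; [exact: finite_set1|].
- by move=> z [->//|/FA[]].
- exists (A `&` U); split; [exact: openI|exact: subIsetl| |].
    by exists x; split=> //; left.
  apply: openly_many_sub mF; last exact: subsetUr.
  move=> z [Az Vz]; split=> // -[_ Uz].
  by have : (U `&` V) z by []; rewrite UV.
Qed.

(** * Convergent sequences *)

(** Convergence to [x] already forces the points other than [x] to be isolated:
    away from a neighbourhood of [x] only finitely many points are left, and a
    finite set is closed.  The limit is not isolated because [S] is
    infinite. *)
Lemma nontrivial_convergent_sequence_intro (X : topologicalType) (S : set X)
    (x : X) :
  hausdorff_space X -> S #= [set: nat] -> S x ->
  (forall U, nbhs x U -> finite_set (S `\` U)) ->
  nontrivial_convergent_sequence S.
Proof.
move=> hX cS Sx limS; split=> //; exists x; split=> //.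
have infS : infinite_set S.
  by rewrite (eq_finite_set cS); exact: infinite_nat.
apply/seteqP; split=> [y [Sy niy]|_ ->]; last first.
  split=> // -[_ [V /limS fV VS]]; apply: infS.
  rewrite -(setUIDK S V) setIC VS.
  by rewrite finite_setU; split.
apply: contrapT => /eqP/(hausdorff_disjoint_open hX)[V [U [oV oU Vy Ux VU]]].
apply: niy; split; first exact: mem_set.
have fSU : finite_set (S `\` U `\ y).
  by apply: finite_setD; apply: limS; exact: open_nbhs_nbhs.
have clF := accessible_finite_set_closed.1 (hausdorff_accessible hX) _ fSU.
exists (V `&` ~` (S `\` U `\ y)).
  apply: open_nbhs_nbhs; split; first exact/openI/closed_openC.
  by split=> // -[_]; apply.
apply/seteqP; split=> [z [[Vz nz] Sz]|_ ->]; last first.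
  by split=> //; split=> // -[_]; apply.
apply: contrapT => zy; apply: nz; split=> //; split=> // Uz.
by have : (V `&` U) z by []; rewrite VU.
Qed.

Lemma convergent_setU_finite (X : topologicalType) (S F : set X) :
  hausdorff_space X -> nontrivial_convergent_sequence S -> finite_set F ->
  nontrivial_convergent_sequence (S `|` F).
Proof.
move=> hX [cS [x [xS limS]]] fF.
have [Sx _] : (S `\` isolated S) x by rewrite xS.
apply: (nontrivial_convergent_sequence_intro (x := x)) => //.
- apply: eq_card_nat.
    rewrite -bigcup2E; apply: bigcup_countable => // -[|[|i]] _ //=.
      by rewrite (eq_countable cS).
    exact: finite_set_countable.
  apply: sub_infinite_set (@subsetUl _ S F) _.
  by rewrite (eq_finite_set cS); exact: infinite_nat.
- by left.
- by move=> U /limS fSU; rewrite setDUl finite_setU; split=> //;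
  exact: finite_setD.
Qed.

Lemma limit_closure (X : topologicalType) (S A : set X) (x : X) :
  (forall U, nbhs x U -> finite_set (S `\` U)) -> infinite_set (S `&` A) ->
  closure A x.
Proof.
move=> limS infSA U xU; apply: contrapT => nAU; apply: infSA.
apply: sub_finite_set (limS _ xU) => y [Sy Ay]; split=> // Uy.
by apply: nAU; exists y.
Qed.

(** * Open and nowhere dense sets in the hyperspace *)

Lemma open_hit (X : topologicalType) (A : set X) :
  open A -> open [set F : CL X | sval F `&` A !=set0].
Proof.
move=> oA; have [->|/set0P A0] := eqVneq A set0.
  suff -> : [set F : CL X | sval F `&` set0 !=set0] = set0 by exact: open0.
  by rewrite -subset0 => F [x []].
apply/vietoris_openP; exists [set [set A; setT]] => [_ ->|].
  split; [exact: finite_set2|by exists A; left|].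
  move=> V [->|->]; split=> //; first exact: openT.
  by have [x _] := A0; exists x.
rewrite bigcup_set1; apply/seteqP; split=> F /=.
  by move=> [_]; apply; left.
move=> FA; split; first by move=> x _; exists setT => //; right.
by move=> V [->//|->]; rewrite setIT; have [_] := svalP F.
Qed.

Lemma open_openly_many (X : topologicalType) n (A : set X) :
  open [set F : CL X | openly_many n A (sval F)].
Proof.
elim: n A => [|n IH] A; first exact: openT.
rewrite [X in open X](_ : _ =
  \bigcup_(U in [set U | open U /\ U `<=` A])
   ([set F : CL X | sval F `&` U !=set0] `&`
    [set F : CL X | openly_many n (A `\` U) (sval F)])).
  by apply: bigcup_open => U [oU _]; apply: openI => //; exact: open_hit.
by apply/seteqP; split=> [F [U [oU UA FU mF]]|F [U [oU UA] [FU mF]]]; exists U.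
Qed.

(** Near an [S] that meets [A] there is [S `|` F], where [F] is a finite set
    with at least [n] points, taken from [A] and from one member [B] of the
    family that describes the given Vietoris neighbourhood of [S]: so [S `|` F]
    stays in this neighbourhood.  Some [B] meets [A] because [S] does. *)
Lemma nowhere_dense_few (X : topologicalType) n (A : set X) :
  hausdorff_space X -> crowded X -> open A ->
  nowhere_dense [set S : set_type (Sc X) |
    sval (set_val S) `&` A !=set0 /\ ~ openly_many n A (sval (set_val S))].
Proof.
move=> hX cX oA; set N := [set _ | _]; apply/nowhere_denseP => W oW W0.
have [WN0|/eqP/set0P[S [WS [[s [Ss As]] _]]]] := pselect (W `&` N = set0).
  by exists W; split.
have [O oO OW] := oW.
have [U [iU US UO]] : exists U,
    [/\ vietoris_index U, vietoris_basic U (set_val S) &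
        vietoris_basic U `<=` O].
  move: oO => /vietoris_openP[D Di DO].
  have : O (set_val S) by move: WS; rewrite -OW.
  rewrite -DO => -[U DU US]; exists U; split=> //; first exact: Di.
  by move=> F FU; exists U.
have [B UB Bs] := US.1 _ Ss.
have oB : open B by have [_ _ /(_ _ UB)[]] := iU.
have [|F [fF FAB mF]] :=
  crowded_finite_openly_many n hX cX (openI oA oB); first by exists s.
have ncS : nontrivial_convergent_sequence (sval (set_val S)) := set_valP S.
have SF0 : nonempty_closed (sval (set_val S) `|` F).
  have [clS _] := svalP (set_val S); split; last by exists s; left.
  apply: closedU => //.
  exact: accessible_finite_set_closed.1 (hausdorff_accessible hX) _ fF.
pose G : CL X := exist _ _ SF0.
have ScG : G \in Sc X by apply/mem_set; exact: convergent_setU_finite.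
pose G' : set_type (Sc X) := SigSub ScG.
exists (W `&` (set_val @^-1` [set F : CL X | openly_many n A (sval F)])); split.
- apply: openI => //; apply: open_comp; last exact: open_openly_many.
  by move=> ? _; exact: initial_continuous.
- exists G'; split.
    rewrite -OW; apply: UO; split.
      by move=> x [/US.1//|/FAB[_ Bx]]; exists B.
    by move=> V /US.2[x [Sx Vx]]; exists x; split=> //; left.
  by apply: openly_many_sub mF; [exact: subIsetl|exact: subsetUr].
- exact: subIsetl.
- by rewrite -subset0 => H [[_ mH] [_ nmH]]; exact: nmH.
Qed.

(** * The main result *)

Theorem theorem3p7 (X : topologicalType) (hX : tychonoff_space X)
  (hFU : frechet_urysohn X) (hnd : ~ discrete_space X) (hc : crowded X) :
  meager_space (set_type (Sc X)).
Proof.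
have [_ hausX] := hX.
apply: meager_space_local => S.
have [cS [x [xS limS]]] : nontrivial_convergent_sequence (sval (set_val S)).
  exact: set_valP S.
have [Sx _] : (sval (set_val S) `\` isolated (sval (set_val S))) x.
  by rewrite xS.
have [y Sy xy] : exists2 y, sval (set_val S) y & x != y.
  apply: contrapT => Sx1.
  have : infinite_set (sval (set_val S)).
    by rewrite (eq_finite_set cS); exact: infinite_nat.
  apply; apply: sub_finite_set (finite_set1 x) => y Sy.
  apply: contrapT => yx; apply: Sx1; exists y => //.
  by apply/eqP => xy; apply: yx.
have [A [B [oA oB Ax By AB]]] := disjoint_closures hX xy.
pose hit C := [set T : set_type (Sc X) | sval (set_val T) `&` C !=set0].
pose few C n := [set T : set_type (Sc X) |
  hit C T /\ ~ openly_many n C (sval (set_val T))].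
have ohit C : open C -> open (hit C).
  move=> oC; apply: (open_comp _ (open_hit oC)) => ? _.
  exact: initial_continuous.
(* Odd indices enumerate the pieces for [A], even ones those for [B]. *)
exists (hit A `&` hit B), (fun k => few (if odd k then A else B) k./2); split.
- by apply: openI; exact: ohit.
- by split; [exists x|exists y].
- by move=> k; apply: nowhere_dense_few => //; case: odd.
move=> T [TA TB]; apply: contrapT => nfew.
have many C b : C = (if b then A else B) -> hit C T ->
    infinite_set (sval (set_val T) `&` C).
  move=> CE TC; apply: openly_many_infinite => n.
  apply: contrapT => nm; apply: nfew; exists (b + n.*2)%N => //.
  by rewrite half_bit_double oddD odd_double addbF oddb -CE.
have [_ [t [_ limT]]] : nontrivial_convergent_sequence (sval (set_val T)).
  exact: set_valP T.
have : (closure A `&` closure B) t.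
  split; apply: limit_closure limT _; first exact: (many A true).
  exact: (many B false).
by rewrite AB.
Qed.
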